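(* Let $\omega$ be a pure, $\theta$-invariant and $\sigma$-local state on $\mathcal{A}$. Let $\alpha\in\operatorname{Aut}(\mathcal{A})$ commute with $\theta$, and suppose that $\alpha\circ\sigma\circ\alpha^{-1}\circ\sigma^{-1}=\operatorname{Ad}_v$ for some $v\in\mathcal{U}(\mathcal{A})$ satisfying $\theta(v)=v$. Then $\omega\circ\alpha$ is pure, $\theta$-invariant and $\sigma$-local, and $\mathcal{N}_\sigma(\omega\circ\alpha)=\mathcal{N}_\sigma(\omega)$.
   Context: Setting: $N\in\mathbb{N}$, $\mathcal{H}=\ell^2(\mathbb{Z})\otimes\mathbb{C}^{2N}$, $X$ the position operator, $\Xi$ an anti-unitary on $\mathcal{H}$ with $\Xi^2=\mathbb{1}$ and $[\Xi,X]=0$. $\mathcal{A}=\operatorname{CAR}_{\rm sd}(\mathcal{H},\Xi)$ is the universal unital C*-algebra generated by $B(\psi)$, $\psi\in\mathcal{H}$, with $\psi\mapsto B(\psi)$ linear, $B(\Xi\psi)=B(\psi)^*$ and $\{B(\psi)^*,B(\varphi)\}=\langle\psi,\varphi\rangle1_{\mathcal{A}}$ (inner product linear in the second argument). $\mathcal{U}(\mathcal{A})$ is its unitary group and $\operatorname{Ad}_u(a):=u^*au$. The parity automorphism $\theta$ is given by $\theta(B(\psi))=-B(\psi)$. $\Sigma=\operatorname{sgn}(X)$ acts as $+1$ on sites $x>0$ and $-1$ on sites $x\le0$, and $\sigma$ is the automorphism with $\sigma(B(\psi))=B(\Sigma\psi)$. A pure state $\omega$ is $\sigma$-local iff there is $u\in\mathcal{U}(\mathcal{A})$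 with $\omega\circ\sigma=\omega\circ\operatorname{Ad}_u$. For a $\theta$-invariant ($\omega\circ\theta=\omega$) $\sigma$-local pure state, $\mathcal{N}_\sigma(\omega):=\omega(u^*\theta(u))\in\{\pm1\}$, independent of the choice of $u$. *)

(* Defs.v *)
From HB Require Import structures.
From mathcomp Require Import all_boot all_order all_algebra.
From mathcomp Require Import ring.
From mathcomp Require Import complex.
From mathcomp Require Import all_classical all_reals.
From mathcomp Require Import ereal topology normedtype esum.
From mathcomp Require summability.

Set Implicit Arguments.
Unset Strict Implicit.
Unset Printing Implicit Defensive.

Import Order.TTheory GRing.Theory Num.Theory.
Import numFieldNormedType.Exports.

Local Open Scope classical_set_scope.
Local Open Scope ring_scope.

(** ell^2(Z) (x) C^(2N) is realised as the space of square summable functions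
    from Z to C^(2N). *)

Definition normsq (R : realType) (z : R[i]) : R :=
  complex.Re z ^+ 2 + complex.Im z ^+ 2.

Definition site_normsq (R : realType) (N : nat)
    (psi : int -> 'cV[R[i]]_(2 * N)) (x : int) : R :=
  \sum_(k < 2 * N) normsq (psi x k 0).

Definition square_summable (R : realType) (N : nat) :
    {pred int -> 'cV[R[i]]_(2 * N)} :=
  fun psi => `[< (\esum_(x in [set: int]) (site_normsq psi x)%:E < +oo)%E >].

Section square_summable_theory.
Variables (R : realType) (N : nat).
Implicit Types (z w : R[i]) (psi phi : int -> 'cV[R[i]]_(2 * N)).

Lemma normsq_ge0 z : 0 <= normsq z.
Proof. by rewrite addr_ge0 ?sqr_ge0. Qed.

Lemma site_normsq_ge0 psi x : 0 <= site_normsq psi x.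
Proof. by apply: sumr_ge0 => k _; exact: normsq_ge0. Qed.

Lemma normsqM z w : normsq (z * w) = normsq z * normsq w.
Proof. by case: z w => [a b] [c d]; rewrite /normsq /=; ring. Qed.

Lemma normsqD z w : normsq (z + w) <= 2 * normsq z + 2 * normsq w.
Proof.
case: z w => [a b] [c d]; rewrite /normsq /= -subr_ge0.
rewrite (_ : _ - _ = (a - c) ^+ 2 + (b - d) ^+ 2); last by ring.
by rewrite addr_ge0 ?sqr_ge0.
Qed.

Lemma square_summable_le (c : R) psi phi : 0 <= c ->
  (forall x, site_normsq phi x <= c * site_normsq psi x) ->
  psi \in @square_summable R N -> phi \in @square_summable R N.
Proof.
move=> c0 le_phi /asboolP psi_fin; apply/asboolP.
set S := (X in (X < _)%E) in psi_fin.
have S0 : (0 <= S)%E by apply: esum_ge0 => x _; rewrite lee_fin site_normsq_ge0.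
apply: (@le_lt_trans _ _ (c%:E * S)%E); last first.
  by rewrite -(fineK (_ : S \is a fin_num)) ?ge0_fin_numE// -EFinM ltry.
apply: ge_ereal_sup => _ [A [finA _] <-].
apply: (@le_trans _ _ (c%:E * \sum_(x \in A) (site_normsq psi x)%:E)%E).
  rewrite ge0_mule_fsumr; last by move=> x; rewrite lee_fin site_normsq_ge0.
  by apply: lee_fsum => // x _; rewrite -EFinM lee_fin.
by rewrite lee_wpmul2l ?lee_fin// ereal_sup_ubound//; exists A.
Qed.

Lemma square_summable_submod : submod_closed (@square_summable R N).
Proof.
split=> [|z psi phi psi2 phi2].
  apply/asboolP; rewrite esum1 ?ltry// => x _; congr (_%:E).
  by apply: big1 => k _; rewrite mxE /normsq /= expr0n addr0.
have : z *: psi \in @square_summable R N.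
  apply: square_summable_le psi2; first exact: (normsq_ge0 z).
  move=> x; rewrite mulr_sumr; apply: ler_sum => k _.
  by rewrite mxE normsqM.
move=> /asboolP zpsi2; move: phi2 => /asboolP phi2; apply/asboolP.
have /le_lt_trans : (\esum_(x in [set: int]) (site_normsq (z *: psi + phi) x)%:E
    <= \esum_(x in [set: int])
         ((2 * site_normsq (z *: psi) x)%:E + (2 * site_normsq phi x)%:E))%E.
  apply: le_esum => x _; rewrite -EFinD lee_fin !mulr_sumr -big_split /=.
  by apply: ler_sum => k _; rewrite mxE normsqD.
apply; rewrite esumD; [|by move=> x _; rewrite lee_fin mulr_ge0// site_normsq_ge0..].
have twice f : (forall x : int, 0 <= f x) ->
    (\esum_(x in [set: int]) (f x)%:E < +oo ->
     \esum_(x in [set: int]) (2 * f x : R)%:E < +oo)%E.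
  move=> f0 ffin.
  rewrite (eq_esum (b := fun x => (f x)%:E + (f x)%:E)%E); last first.
    by move=> x _; rewrite -EFinD mulr_natl.
  by rewrite esumD ?lte_add_pinfty// => x _; rewrite lee_fin.
by rewrite lte_add_pinfty// twice// => x; exact: site_normsq_ge0.
Qed.

HB.instance Definition _ :=
  GRing.isSubmodClosed.Build R[i] (int -> 'cV[R[i]]_(2 * N))
    (@square_summable R N) square_summable_submod.
End square_summable_theory.

Record ell2 (R : realType) (N : nat) := Ell2 {
  ell2_fun :> int -> 'cV[R[i]]_(2 * N);
  _ : ell2_fun \in @square_summable R N }.

Section ell2_lmodule.
Variables (R : realType) (N : nat).
HB.instance Definition _ := [isSub for @ell2_fun R N].
HB.instance Definition _ := [Choice of ell2 R N by <:].
HB.instance Definition _ := [SubChoice_isSubLmodule of ell2 R N by <:].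
End ell2_lmodule.

(** Inner product, antilinear in the first argument; the sum over Z is
    unconditional (the limit over all finite subsets of Z) *)
Definition inner (R : realType) (N : nat) (psi phi : ell2 R N) : R[i] :=
  summability.sum
    (fun x : int => \sum_(k < 2 * N) (psi x k 0)^* * phi x k 0 : R[i]^o).

Definition antiunitary (R : realType) (N : nat) (T : ell2 R N -> ell2 R N) :=
  [/\ forall (z : R[i]) psi phi, T (z *: psi + phi) = z^* *: T psi + T phi,
      forall psi phi, inner (T psi) (T phi) = inner phi psi
    & bijective T].

(** Graph of the unbounded position operator X: psi lies in the domain of X and
    phi = X psi.  The domain condition is that phi is again square summable,
    which is part of its type *)
Definition position_graph (R : realType) (N : nat) (psi phi : ell2 R N) : Prop :=
  forall x : int, phi x = x%:~R *: psi x.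

(** T X = X T with equality of domains, for bijective T *)
Definition commutes_with_position (R : realType) (N : nat)
    (T : ell2 R N -> ell2 R N) : Prop :=
  forall psi phi, position_graph psi phi <-> position_graph (T psi) (T phi).

Definition site_sgn (R : realType) (x : int) : R[i] :=
  if 0 < x then 1 else -1.

Lemma site_sgn_subproof (R : realType) (N : nat) (psi : ell2 R N) :
  (fun x => site_sgn R x *: psi x) \in @square_summable R N.
Proof.
case: psi => psi /= psi2.
apply: square_summable_le psi2; first exact: ler01.
move=> x; rewrite mul1r; apply: ler_sum => k _.
rewrite mxE normsqM /site_sgn; case: ifP => _.
  by rewrite [normsq 1]/normsq /= expr1n expr0n addr0 mul1r.
by rewrite [normsq (-1)]/normsq /= sqrrN expr1n oppr0 expr0n addr0 mul1r.
Qed.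

Definition Sigma (R : realType) (N : nat) (psi : ell2 R N) : ell2 R N :=
  Ell2 (site_sgn_subproof psi).

(** Unital C*-algebras.  The zero algebra is excluded, as for every algType.
    The norm is a real-valued field of the mixin: the hierarchy has no structure
    joining normed modules with rings other than numDomainType *)
HB.mixin Record isCStarAlgebra (R : realType) A of GRing.Algebra R[i] A := {
  star : A -> A;
  cnorm : A -> R;
  starK : involutive star;
  starD : forall a b, star (a + b) = star a + star b;
  starZ : forall (z : R[i]) a, star (z *: a) = z^* *: star a;
  starM : forall a b, star (a * b) = star b * star a;
  cnorm0_eq0 : forall a, cnorm a = 0 -> a = 0;
  cnormD_le : forall a b, cnorm (a + b) <= cnorm a + cnorm b;
  cnormZ : forall (z : R[i]) a, cnorm (z *: a) = Num.sqrt (normsq z) * cnorm a;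
  cnormM_le : forall a b, cnorm (a * b) <= cnorm a * cnorm b;
  cnorm_starM : forall a, cnorm (star a * a) = cnorm a ^+ 2;
  cnorm_complete : forall s : nat -> A,
    (forall e : R, 0 < e -> exists n, forall i j,
       (n <= i)%N -> (n <= j)%N -> cnorm (s i - s j) < e) ->
    exists a, forall e : R, 0 < e -> exists n, forall i,
       (n <= i)%N -> cnorm (s i - a) < e
}.

#[short(type="cstarType")]
HB.structure Definition CStarAlgebra (R : realType) :=
  {A of isCStarAlgebra R A & GRing.Algebra R[i] A}.

Definition star_morphism (R : realType) (A D : cstarType R) (f : A -> D) :=
  [/\ linear f, monoid_morphism f & forall a, f (star a) = star (f a)].

Record starAut (R : realType) (A : cstarType R) := StarAut {
  aut_fun :> A -> A;
  aut_inv : A -> A;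
  aut_morphism : star_morphism aut_fun;
  autK : cancel aut_fun aut_inv;
  autVK : cancel aut_inv aut_fun }.

Section CAR.
Variables (R : realType) (N : nat) (Xi : ell2 R N -> ell2 R N).

Definition CAR_relations (A : cstarType R) (B : ell2 R N -> A) :=
  [/\ linear B,
      forall psi, B (Xi psi) = star (B psi)
    & forall psi phi, star (B psi) * B phi + B phi * star (B psi) =
                      (inner psi phi)%:A].

(** (A, B) is the universal unital C*-algebra with these generators and
    relations; uniqueness of f expresses that the B psi generate A *)
Definition is_CARsd (A : cstarType R) (B : ell2 R N -> A) :=
  CAR_relations B /\
  forall (D : cstarType R) (b : ell2 R N -> D), CAR_relations b ->
    exists! f : A -> D, star_morphism f /\ forall psi, f (B psi) = b psi.

End CAR.

Section states.
Variables (R : realType) (A : cstarType R).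
Implicit Types (u : A) (omega : A -> R[i]).

Definition unitary u := star u * u = 1 /\ u * star u = 1.

Definition Ad u : A -> A := fun a => star u * a * u.

Definition is_state omega :=
  [/\ scalar omega, forall a, 0 <= omega (star a * a) & omega 1 = 1].

(** Extreme points of the state space.  Here 0 < t < 1 forces t to be real *)
Definition pure_state omega := is_state omega /\
  forall (omega1 omega2 : A -> R[i]) (t : R[i]),
    is_state omega1 -> is_state omega2 -> 0 < t < 1 ->
    (forall a, omega a = t * omega1 a + (1 - t) * omega2 a) ->
    omega1 = omega /\ omega2 = omega.

Definition implements (sigma : A -> A) omega u :=
  unitary u /\ omega \o sigma = omega \o Ad u.

Definition sigma_local (sigma : A -> A) omega :=
  exists u, implements sigma omega u.

(** The chosen u is arbitrary, and the default value 1 is only used when omega is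
    not sigma-local.  For omega pure, theta-invariant and sigma-local, the value
    is +1 or -1 and does not depend on u *)
Definition sigma_index (theta sigma : A -> A) omega : R[i] :=
  let u := xget 1 [set u | implements sigma omega u] in
  omega (star u * theta u).

End states.

(* Main.v *)
(** The index of a pure state does not depend on the implementing unitary: two
    choices differ by a unitary [x] with [omega (x^* a x) = omega a], and purity
    forces [x] to act on [omega] as a phase.  To see this without the GNS
    representation, write a multiple of [omega] as the sum of the positive
    functionals [a |-> omega ((1 + c x)^* a (1 + c x))] for [c] and [- c], where
    [c = 1/2] or [c = 'i/2]; by extremality each of them is a multiple of [omega].

    If [u] implements [sigma] in [omega], then [alpha^-1 (sigma^-1 v * u)]
    implements [sigma] in [omega \o alpha], and it has the same index because
    [theta] fixes [sigma^-1 v]. *)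

Require Import Defs.
From HB Require Import structures.
From mathcomp Require Import all_boot all_order all_algebra.
From mathcomp Require Import ring.
From mathcomp Require Import complex.
From mathcomp Require Import all_classical all_reals.

Import Order.TTheory GRing.Theory Num.Theory.
Local Open Scope ring_scope.

Lemma linear_fun0 {K : pzRingType} {U V : lmodType K} {f : U -> V} :
  linear f -> f 0 = 0.
Proof.
by move=> fl; rewrite -[0 in LHS](addNr 0) -scaleN1r fl scaleN1r addNr.
Qed.

(** * Unitaries and their adjoint action *)

Section star_algebra.
Context {R : realType} {A : cstarType R}.
Implicit Types (a u x : A).

Lemma star1 : star (1 : A) = 1.
Proof. by rewrite -[LHS]mulr1 -{2}[1]starK -starM mulr1 starK. Qed.

Lemma unitaryM u x : unitary u -> unitary x -> unitary (u * x).
Proof.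
move=> [u1 u2] [x1 x2]; split; rewrite starM.
  by rewrite mulrA -[_ * u]mulrA u1 mulr1.
by rewrite mulrA -[u * x * _]mulrA x2 mulr1.
Qed.

Lemma unitary_star u : unitary u -> unitary (star u).
Proof. by move=> [u1 u2]; split; rewrite starK. Qed.

Lemma AdM u x a : Ad (u * x) a = Ad x (Ad u a).
Proof. by rewrite /Ad starM !mulrA. Qed.

End star_algebra.

(** * Star morphisms acting on unitaries and states *)

Section morphisms.
Context {R : realType} {A : cstarType R}.
Implicit Types (a b u : A) (c : R[i]) (omega : A -> R[i]).

Lemma star_morphism_unitary {D : cstarType R} {f : A -> D} u :
  star_morphism f -> unitary u -> unitary (f u).
Proof. by move=> [_ [f1 fM] fS] [u1 u2]; split; rewrite -fS -fM ?u1 ?u2. Qed.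

Lemma star_morphism_Ad {D : cstarType R} {f : A -> D} u a :
  star_morphism f -> f (Ad u a) = Ad (f u) (f a).
Proof. by move=> [_ [_ fM] fS]; rewrite /Ad !fM fS. Qed.

Lemma star_morphism_comp {D E : cstarType R} {f : D -> E} {g : A -> D} :
  star_morphism f -> star_morphism g -> star_morphism (f \o g).
Proof.
move=> [fl [f1 fM] fS] [gl [g1 gM] gS]; split.
- by move=> c a b; rewrite /= gl fl.
- by split=> [|a b] /=; rewrite ?g1 ?f1 ?gM ?fM.
- by move=> a /=; rewrite gS fS.
Qed.

Lemma star_morphism_cancel {D : cstarType R} {f : A -> D} {g : D -> A} :
  cancel f g -> cancel g f -> star_morphism f -> star_morphism g.
Proof.
move=> fK gK [fl [f1 fM] fS]; split.
- by move=> c a b; apply: (can_inj fK); rewrite fl !gK.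
- by split=> [|a b]; apply: (can_inj fK); rewrite ?f1 ?fM !gK.
- by move=> a; apply: (can_inj fK); rewrite fS !gK.
Qed.

Lemma is_state_comp {D : cstarType R} {f : D -> A} {omega} :
  star_morphism f -> is_state omega -> is_state (omega \o f).
Proof.
move=> [fl [f1 fM] fS] [ol opos o1]; split=> [c a b|a|] /=.
- by rewrite fl ol.
- by rewrite fM fS.
- by rewrite f1.
Qed.

End morphisms.

(** Composition with [f] is an affine bijection of state spaces, with inverse composition with [g],
    so it preserves extreme points. *)
Lemma pure_state_comp {R : realType} {A D : cstarType R} {f : D -> A}
    {g : A -> D} {omega : A -> R[i]} :
  cancel f g -> cancel g f -> star_morphism f ->
  pure_state omega -> pure_state (omega \o f).
Proof.
move=> fK gK fmor [ost oext]; split; first exact: is_state_comp.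
have gmor := star_morphism_cancel fK gK fmor.
move=> o1 o2 t st1 st2 t01 eq_o.
have [|e1 e2] := oext _ _ t (is_state_comp gmor st1) (is_state_comp gmor st2) t01.
  by move=> a; rewrite /= -eq_o /= gK.
by split; apply/funext=> a; [rewrite -e1 | rewrite -e2]; rewrite /= fK.
Qed.

(** * Extremality, and elements whose adjoint action fixes a pure state *)

Section pure_states.
Context {R : realType} {A : cstarType R}.
Implicit Types (a b u x : A) (c : R[i]) (omega : A -> R[i]).

Lemma is_state_scale {f : A -> R[i]} {r : R[i]} : scalar f ->
  (forall a, 0 <= f (star a * a)) -> f 1 = r -> 0 < r ->
  is_state (fun a => r^-1 * f a).
Proof.
move=> fl fpos f1 r_gt0; split=> [c a b|a|].
- by rewrite fl; ring.
- by rewrite mulr_ge0 // invr_ge0 ltW.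
- by rewrite f1 mulVf // gt_eqF.
Qed.

(** Evaluation at 1 gives [s = f 1 + g 1], so [omega] is the convex combination of the normalised
    [f] and [g] with weight [f 1 / s], and extremality applies. *)
Lemma pure_state_dominated {omega} {f g : A -> R[i]} {s : R[i]} :
  pure_state omega ->
  scalar f -> (forall a, 0 <= f (star a * a)) -> 0 < f 1 ->
  scalar g -> (forall a, 0 <= g (star a * a)) -> 0 < g 1 ->
  (forall a, f a + g a = s * omega a) ->
  forall a, f a = f 1 * omega a.
Proof.
move=> [[_ _ o1] oext] fl fpos f1 gl gpos g1 fg a.
have sE : s = f 1 + g 1 by rewrite fg o1 mulr1.
have s_gt0 : 0 < s by rewrite sE addr_gt0.
have s_neq0 : s != 0 by rewrite gt_eqF.
have t1E : 1 - f 1 / s = g 1 / s.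
  by rewrite -[1](divff s_neq0) -mulrBl {1}sE addrAC subrr add0r.
have t01 : 0 < f 1 / s < 1 by rewrite divr_gt0 //= -subr_gt0 t1E divr_gt0.
have [b | e1 _] := oext _ _ _ (is_state_scale fl fpos erefl f1)
    (is_state_scale gl gpos erefl g1) t01.
  have f1_neq0 : f 1 != 0 by rewrite gt_eqF.
  have g1_neq0 : g 1 != 0 by rewrite gt_eqF.
  apply: (mulfI s_neq0); rewrite -fg t1E.
  by field; rewrite s_neq0 f1_neq0 g1_neq0.
by rewrite -e1 mulrA divff ?mul1r // gt_eqF.
Qed.

(** In the GNS picture, the positive functional of the vector (1 + c x) Omega. *)
Definition perturb omega x c a := omega (star (1 + c *: x) * a * (1 + c *: x)).

Lemma perturb_scalar omega x c : scalar omega -> scalar (perturb omega x c).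
Proof.
by move=> ol d a b; rewrite /perturb [_ * (d *: a + b)]mulrDr mulrDl -scalerAr -scalerAl ol.
Qed.

Lemma perturb_ge0 omega x c a : (forall b, 0 <= omega (star b * b)) ->
  0 <= perturb omega x c (star a * a).
Proof.
by move=> opos; rewrite /perturb mulrA -starM -mulrA; exact: opos.
Qed.

(** Invariance under [Ad x] turns the term quadratic in [c] back into a multiple of [omega]; only
    the cross terms can differ from such a multiple. *)
Lemma perturbE {omega x} c a : scalar omega ->
  (forall b, omega (Ad x b) = omega b) ->
  perturb omega x c a =
    (1 + c^* * c) * omega a + (c * omega (a * x) + c^* * omega (star x * a)).
Proof.
move=> ol omega_x.
have oD b b' : omega (b + b') = omega b + omega b'.
  by rewrite -[b]scale1r ol mul1r scale1r.
have o0 : omega 0 = 0.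
  by apply/eqP; rewrite -(inj_eq (addrI (omega 0))) -oD !addr0.
have oZ d b : omega (d *: b) = d * omega b.
  by rewrite -[_ *: _]addr0 ol o0 addr0.
set rhs := RHS; rewrite /perturb starD star1 starZ !mulrDl !mulrDr !mul1r !mulr1.
rewrite -!scalerAl -!scalerAr scalerA !oD !oZ -[star x * a * x]/(Ad x a) omega_x.
by rewrite /rhs; ring.
Qed.

(* The weight 1/2 keeps both functionals nonzero: positivity at [c] and [- c]
   bounds [`|c * omega x + c^* * omega (star x)|] by 2 < 2 (1 + 1/4). *)
Lemma pure_state_fixed_half {omega x} c : pure_state omega ->
  (forall b, omega (Ad x b) = omega b) -> c^* * c = 1 ->
  forall a, c * omega (a * x) + c^* * omega (star x * a) =
            (c * omega x + c^* * omega (star x)) * omega a.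
Proof.
move=> opure omega_x cc a.
have [[ol opos o1] _] := opure.
have half_conj (d : R[i]) : (d / 2)^* = d^* / 2.
  by rewrite rmorphM fmorphV rmorph_nat.
have quarter (d : R[i]) : d^* * d = 1 -> (d / 2)^* * (d / 2) = 4^-1.
  move=> dd; rewrite half_conj (_ : _ * _ = (d^* * d) / 4); last by field.
  by rewrite dd mul1r.
have perturb_half (d : R[i]) b : d^* * d = 1 -> perturb omega x (d / 2) b =
    (1 + 4^-1) * omega b + (d * omega (b * x) + d^* * omega (star x * b)) / 2.
  by move=> dd; rewrite perturbE // quarter // half_conj; ring.
have p_gt0 (d : R[i]) : d^* * d = 1 -> 0 < perturb omega x (d / 2) 1.
  move=> dd.
  have := perturb_ge0 omega x d 1 opos; rewrite star1 mulr1.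
  rewrite perturb_half // perturbE // mul1r mulr1 o1 dd !mulr1.
  set e := d * _ + _ => e_ge0.
  rewrite (_ : _ + _ = 4^-1 + (1 + 1 + e) / 2); last by field.
  by apply: ltr_wpDr; rewrite ?invr_gt0 ?ltr0n // divr_ge0.
have Nconj : (- c)^* = - c^* by rewrite rmorphN.
have NcNc : (- c)^* * - c = 1 by rewrite Nconj mulrNN.
(* The cross terms change sign between [c] and [- c], so they cancel in the sum. *)
have sum_perturb b : perturb omega x (c / 2) b + perturb omega x (- c / 2) b =
    2 * (1 + 4^-1) * omega b.
  by rewrite !perturb_half // Nconj; ring.
have := pure_state_dominated opure
  (perturb_scalar _ _ (c / 2) ol)
  (fun b => perturb_ge0 _ _ _ b opos) (p_gt0 _ cc)
  (perturb_scalar _ _ (- c / 2) ol)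
  (fun b => perturb_ge0 _ _ _ b opos) (p_gt0 _ NcNc) sum_perturb a.
(* Both sides contain [(1 + 4^-1) * omega a]; removing it and the factor 1/2 leaves the cross
   terms. *)
rewrite !perturb_half // mul1r mulr1 o1 mulr1 [RHS]mulrDl => /addrI.
by rewrite mulrAC => /(mulIf _); apply; rewrite invr_eq0 pnatr_eq0.
Qed.

(** In GNS terms, x Omega = omega(x) Omega. The choices [c = 1] and [c = 'i] control the sum and the
    difference of [omega (a * x)] and [omega (star x * a)], hence each of them. *)
Lemma pure_state_fixed_phase {omega x} : pure_state omega ->
  (forall b, omega (Ad x b) = omega b) ->
  forall a, omega (a * x) = omega x * omega a /\
            omega (star x * a) = omega (star x) * omega a.
Proof.
move=> opure omega_x a.
have := pure_state_fixed_half 1 opure omega_x; rewrite rmorph1 mulr1.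
move=> /(_ erefl a); rewrite !mul1r => E1.
have := pure_state_fixed_half 'i opure omega_x; rewrite conjCi mulNr -expr2 sqrCi opprK.
move=> /(_ erefl a); rewrite !mulNr -!mulrBr -mulrA => /(mulfI (neq0Ci _)) E2.
have two : (2 : R[i]) != 0 by rewrite pnatr_eq0.
split; apply: (mulfI two).
  rewrite (_ : _ * omega (a * x) = (omega (a * x) + omega (star x * a)) +
    (omega (a * x) - omega (star x * a))); last by ring.
  by rewrite E1 E2; ring.
rewrite (_ : _ * omega (star x * a) = (omega (a * x) + omega (star x * a)) -
  (omega (a * x) - omega (star x * a))); last by ring.
by rewrite E1 E2; ring.
Qed.

(** * Independence of the index from the implementing unitary *)

Section index.
Context {theta : starAut A} {sigma : A -> A} {omega : A -> R[i]}.
Hypotheses (omega_pure : pure_state omega) (omega_theta : omega \o theta = omega).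

Lemma index_unique u w : implements sigma omega u -> implements sigma omega w ->
  omega (star u * theta u) = omega (star w * theta w).
Proof.
move=> [uu su] [uw sw]; have [w1 w2] := uw.
pose x := star w * u.
have ux : unitary x by apply: unitaryM => //; exact: unitary_star.
have uE : u = w * x by rewrite /x mulrA w2 mul1r.
have [_ [_ thM] _] := aut_morphism theta.
have omega_x b : omega (Ad x b) = omega b.
  rewrite AdM -[LHS]/((omega \o Ad u) _) -su sw /= -AdM w1.
  by rewrite /Ad star1 mul1r mulr1.
have phase := pure_state_fixed_phase omega_pure omega_x.
(* Since [omega] is [theta]-invariant, [theta x] acts by the same phase as [x]. *)
have phase_theta b : omega (b * theta x) = omega x * omega b.
  rewrite -(autVK theta b) -thM -[LHS]/((omega \o theta) _).
  by rewrite -[omega (theta _)]/((omega \o theta) _) omega_theta (phase _).1.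
have lm : omega x * omega (star x) = 1.
  by rewrite mulrC -(phase x).2 ux.1; case: omega_pure => [[]].
rewrite {}uE starM thM -mulrA [star w * _]mulrA mulrA phase_theta.
by rewrite (phase _).2 mulrA lm mul1r.
Qed.

Lemma sigma_indexE u : implements sigma omega u ->
  sigma_index theta sigma omega = omega (star u * theta u).
Proof.
move=> iu; rewrite /sigma_index; apply: index_unique => //.
(* The existence of [u] rules out the default value 1 of [xget]. *)
exact: (xgetPex 1 (P := [set u | implements sigma omega u]%classic) (ex_intro _ u iu)).
Qed.

End index.
End pure_states.

(** * Morphisms out of the CAR algebra *)

Section CAR.
Context {R : realType} {N : nat} {Xi : ell2 R N -> ell2 R N}.
Context {A : cstarType R} {B : ell2 R N -> A}.

Lemma CAR_relations_comp {D : cstarType R} {f : A -> D} :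
  star_morphism f -> CAR_relations Xi B -> CAR_relations Xi (f \o B).
Proof.
move=> [fl [f1 fM] fS] [Bl BX Brel].
split=> [c psi phi|psi|psi phi] /=.
- by rewrite Bl fl.
- by rewrite BX fS.
have fD a b : f (a + b) = f a + f b by rewrite -[a]scale1r fl !scale1r.
by rewrite -!fS -!fM -fD Brel -[_%:A]addr0 fl f1 (linear_fun0 fl) addr0.
Qed.

(** The images of the generators again satisfy the relations, so [f] and [g] are both the unique
    morphism provided by universality. *)
Lemma CARsd_morphism_ext {D : cstarType R} {f g : A -> D} : is_CARsd Xi B ->
  star_morphism f -> star_morphism g -> f \o B = g \o B -> f = g.
Proof.
move=> [Brel univ] fmor gmor fgB.
have [h [_ huniq]] := univ D (f \o B) (CAR_relations_comp fmor Brel).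
rewrite -(huniq f) // -(huniq g) //; split=> // psi.
by rewrite -[LHS]/((g \o B) psi) -fgB.
Qed.

End CAR.

(** * Transport of the index along [alpha] *)

Theorem claim3p9 (R : realType) (N : nat)
  (Xi : ell2 R N -> ell2 R N)
  (Xi_antiunitary : antiunitary Xi)
  (Xi_involutive : involutive Xi)
  (Xi_position : commutes_with_position Xi)
  (A : cstarType R) (B : ell2 R N -> A)
  (A_CAR : is_CARsd Xi B)
  (theta : starAut A) (thetaB : forall psi, theta (B psi) = - B psi)
  (sigma : starAut A) (sigmaB : forall psi, sigma (B psi) = B (Sigma psi))
  (omega : A -> R[i])
  (omega_pure : pure_state omega)
  (omega_theta : omega \o theta = omega)
  (omega_local : sigma_local sigma omega)
  (alpha : starAut A)
  (alpha_theta : alpha \o theta = theta \o alpha)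
  (v : A) (v_unitary : unitary v) (theta_v : theta v = v)
  (alpha_sigma : alpha \o sigma \o aut_inv alpha \o aut_inv sigma = Ad v) :
  [/\ pure_state (omega \o alpha),
      (omega \o alpha) \o theta = omega \o alpha,
      sigma_local sigma (omega \o alpha)
    & sigma_index theta sigma (omega \o alpha) = sigma_index theta sigma omega].
Proof.
have thm := aut_morphism theta; have sgm := aut_morphism sigma.
have alm := aut_morphism alpha.
have alVm := star_morphism_cancel (autK alpha) (autVK alpha) alm.
have sgVm := star_morphism_cancel (autK sigma) (autVK sigma) sgm.
(* Both composites send [B psi] to [- B (Sigma psi)]. *)
have theta_sigma : theta \o sigma = sigma \o theta.
  apply: (CARsd_morphism_ext A_CAR); [exact: star_morphism_comp..|].
  have [sl _ _] := sgm.
  apply/funext=> psi /=; rewrite sigmaB !thetaB.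
  by rewrite -[- B psi]addr0 -[in RHS]scaleN1r sl (linear_fun0 sl) addr0 scaleN1r sigmaB.
have [u iu] := omega_local; have [uu su] := iu.
pose v' := aut_inv sigma v.
have theta_v' : theta v' = v'.
  apply: (can_inj (autK sigma)).
  by rewrite -[LHS]/((sigma \o theta) v') -theta_sigma /= autVK.
(* Here [alpha \o sigma = Ad v \o sigma \o alpha = sigma \o Ad v' \o alpha]. Under [omega] the outer
   [sigma] becomes [Ad u], and pulling [Ad (v' * u)] back through [alpha] yields [Ad w]. *)
pose w := aut_inv alpha (v' * u).
have iw : implements sigma (omega \o alpha) w.
  split.
    by apply: star_morphism_unitary => //; apply: unitaryM => //;
       exact: star_morphism_unitary.
  apply/funext=> a /=.
  have -> : alpha (sigma a) = Ad v (sigma (alpha a)).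
    by rewrite -alpha_sigma /= !autK.
  rewrite star_morphism_Ad // autVK AdM -[RHS]/((omega \o Ad u) _) -su /=.
  by rewrite star_morphism_Ad // autVK.
have omega_alpha_pure := pure_state_comp (autK alpha) (autVK alpha) alm omega_pure.
have omega_alpha_theta : (omega \o alpha) \o theta = omega \o alpha.
  by rewrite -[LHS]/(omega \o (alpha \o theta)) alpha_theta -[RHS]/(omega \o alpha)
    -{2}omega_theta.
split=> //; first by exists w.
rewrite (sigma_indexE omega_alpha_pure omega_alpha_theta _ iw).
rewrite (sigma_indexE omega_pure omega_theta _ iu) /=.
have [_ [_ alM] alS] := alm; have [_ [_ thM] _] := thm.
have [v'1 _] := star_morphism_unitary _ sgVm v_unitary.
(* As [alpha] commutes with [theta], it cancels against its inverse in [w]; then [star v'] meets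
   [theta v' = v']. *)
rewrite alM alS -[alpha (theta w)]/((alpha \o theta) w) alpha_theta /= autVK.
by rewrite thM theta_v' starM -mulrA [star v' * _]mulrA v'1 mul1r.
Qed.
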